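(* There exist infinitely many Anosov Lie algebras of dimension $14$ whose real completions are pairwise non-isomorphic as real Lie algebras.
   Context: A rational Lie algebra is a finite-dimensional Lie algebra over $\mathbb{Q}$. The real completion of a rational Lie algebra $\mathfrak{n}$ is the real Lie algebra $\mathfrak{n}\otimes_{\mathbb{Q}}\mathbb{R}$. A rational Lie algebra $\mathfrak{n}$ of dimension $d$ is called Anosov if there exist a Lie algebra automorphism $A$ of $\mathfrak{n}$ and a basis $\beta$ of $\mathfrak{n}$ over $\mathbb{Q}$ such that $A$ is hyperbolic, i.e. all (complex) eigenvalues of $A$ have absolute value different from $1$, and the matrix $[A]_\beta$ of $A$ with respect to $\beta$ lies in $\mathrm{GL}(d,\mathbb{Z})$. *)

(* Defs.v *)
From HB Require Import structures.
From mathcomp Require Import all_boot all_order all_algebra.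
From mathcomp Require Import reals complex.

Set Implicit Arguments.
Unset Strict Implicit.
Unset Printing Implicit Defensive.

Import Order.TTheory GRing.Theory Num.Theory.
Import passmx.
Local Open Scope ring_scope.

Record lieAlgebra (F : fieldType) := LieAlgebra {
  lie_carrier :> vectType F;
  lie_bracket : lie_carrier -> lie_carrier -> lie_carrier;
  lie_linearl : forall y, linear (lie_bracket^~ y);
  lie_linearr : forall x, linear (lie_bracket x);
  lie_alternating : forall x, lie_bracket x x = 0;
  lie_jacobi : forall x y z,
    lie_bracket x (lie_bracket y z) + lie_bracket y (lie_bracket z x)
      + lie_bracket z (lie_bracket x y) = 0 }.

Definition lie_dim (F : fieldType) (g : lieAlgebra F) : nat :=
  \dim {: lie_carrier g}.

Definition lie_morphism (F : fieldType) (g h : lieAlgebra F)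
    (f : 'Hom(lie_carrier g, lie_carrier h)) :=
  forall x y, f (lie_bracket x y) = lie_bracket (f x) (f y).

Definition lie_isomorphism (F : fieldType) (g h : lieAlgebra F)
    (f : 'Hom(lie_carrier g, lie_carrier h)) :=
  bijective f /\ lie_morphism f.

Definition lie_isomorphic (F : fieldType) (g h : lieAlgebra F) :=
  exists f : 'Hom(lie_carrier g, lie_carrier h), lie_isomorphism f.

Definition lie_automorphism (F : fieldType) (g : lieAlgebra F)
    (A : 'End(lie_carrier g)) := lie_isomorphism A.

Section LieTheory.
Variables (F : fieldType) (g : lieAlgebra F).

Lemma lie_br0l (y : g) : lie_bracket 0 y = 0.
Proof.
have := lie_linearl y 0 0 0; rewrite !scale0r !add0r => ->.
by have := lie_linearl y (-1) 0 0; rewrite !scaleN1r oppr0 addr0 addNr.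
Qed.

Lemma lie_br0r (x : g) : lie_bracket x 0 = 0.
Proof. by have := lie_linearr x (-1) 0 0; rewrite !scaleN1r oppr0 addr0 addNr. Qed.

Lemma lie_brDl (x y z : g) :
  lie_bracket (x + y) z = lie_bracket x z + lie_bracket y z.
Proof. by have := lie_linearl z 1 x y; rewrite !scale1r. Qed.

Lemma lie_brDr (x y z : g) :
  lie_bracket x (y + z) = lie_bracket x y + lie_bracket x z.
Proof. by have := lie_linearr x 1 y z; rewrite !scale1r. Qed.

Lemma lie_brZl a (x y : g) : lie_bracket (a *: x) y = a *: lie_bracket x y.
Proof. by have := lie_linearl y a x 0; rewrite lie_br0l !addr0. Qed.

Lemma lie_brZr a (x y : g) : lie_bracket x (a *: y) = a *: lie_bracket x y.
Proof. by have := lie_linearr x a y 0; rewrite lie_br0r !addr0. Qed.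

Lemma lie_br_suml I (r : seq I) (u : I -> g) y :
  lie_bracket (\sum_(i <- r) u i) y = \sum_(i <- r) lie_bracket (u i) y.
Proof.
elim/big_rec2: _ => [|i a b _ <-]; first exact: lie_br0l.
exact: lie_brDl.
Qed.

Lemma lie_br_sumr I (r : seq I) x (u : I -> g) :
  lie_bracket x (\sum_(i <- r) u i) = \sum_(i <- r) lie_bracket x (u i).
Proof.
elim/big_rec2: _ => [|i a b _ <-]; first exact: lie_br0r.
exact: lie_brDr.
Qed.

Lemma lie_anti (x y : g) : lie_bracket x y = - lie_bracket y x.
Proof.
apply/eqP; rewrite -addr_eq0 -(lie_alternating (x + y)) lie_brDl !lie_brDr.
by rewrite !lie_alternating add0r addr0.
Qed.

End LieTheory.

(* The real completion g (x)_Q R is realised on R^d, d = dim_Q g, through the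
   basis (e_i (x) 1)_i, where e is the standard basis of g: the tensor x (x) 1
   is the row vector of coordinates of x, and
   [e_i (x) a, e_j (x) b] = [e_i, e_j] (x) ab.
   By real_completionP below, the result does not depend on the choice of e. *)
Section RealCompletion.
Variables (R : realType) (g : lieAlgebra rat).
Local Notation d := (\dim {: lie_carrier g}).
Local Notation e := (vbasis {: lie_carrier g}).

Definition tensor1 (x : g) : 'rV[R]_d := map_mx ratr (rVof e x).

Definition completion_bracket (u v : 'rV[R]_d) : 'rV[R]_d :=
  \sum_i \sum_j (u 0 i * v 0 j) *: tensor1 (lie_bracket e`_i e`_j).

Lemma tensor1D x y : tensor1 (x + y) = tensor1 x + tensor1 y.
Proof. by rewrite /tensor1 linearD map_mxD. Qed.

Lemma tensor1N x : tensor1 (- x) = - tensor1 x.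
Proof. by rewrite /tensor1 linearN map_mxN. Qed.

Lemma tensor10 : tensor1 0 = 0.
Proof. by rewrite /tensor1 linear0 map_mx0. Qed.

Lemma tensor1Z a x : tensor1 (a *: x) = ratr a *: tensor1 x.
Proof. by rewrite /tensor1 linearZ map_mxZ. Qed.

Lemma tensor1_sum I (r : seq I) (x : I -> g) :
  tensor1 (\sum_(i <- r) x i) = \sum_(i <- r) tensor1 (x i).
Proof.
elim/big_rec2: _ => [|i a b _ <-]; first exact: tensor10.
exact: tensor1D.
Qed.

Lemma tensor1_basis (i : 'I_d) : tensor1 e`_i = delta_mx 0 i.
Proof. by rewrite /tensor1 rVofE ?vbasisP // map_delta_mx. Qed.

Lemma completion_linearl v : linear (completion_bracket^~ v).
Proof.
move=> a u w; rewrite /completion_bracket scaler_sumr -big_split /=.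
apply: eq_bigr => i _; rewrite scaler_sumr -big_split /=.
by apply: eq_bigr => j _; rewrite !mxE mulrDl scalerDl scalerA mulrA.
Qed.

Lemma completion_linearr u : linear (completion_bracket u).
Proof.
move=> a v w; rewrite /completion_bracket scaler_sumr -big_split /=.
apply: eq_bigr => i _; rewrite scaler_sumr -big_split /=.
by apply: eq_bigr => j _; rewrite !mxE mulrDr scalerDl scalerA mulrCA.
Qed.

Lemma completion_alternating u : completion_bracket u u = 0.
Proof.
have E : completion_bracket u u = - completion_bracket u u.
  rewrite {1}/completion_bracket exchange_big /= /completion_bracket -sumrN.
  apply: eq_bigr => i _; rewrite -sumrN; apply: eq_bigr => j _.
  by rewrite lie_anti tensor1N scalerN mulrC.
by apply/rowP => i; have /rowP/(_ i) := E; rewrite !mxE => /eqP;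
  rewrite -addr_eq0 -mulr2n mulrn_eq0 /= => /eqP.
Qed.

Lemma tensor1_bracket x y :
  tensor1 (lie_bracket x y) = completion_bracket (tensor1 x) (tensor1 y).
Proof.
rewrite {1}(coord_vbasis (memvf x)) {1}(coord_vbasis (memvf y)).
rewrite lie_br_suml tensor1_sum; apply: eq_bigr => i _.
rewrite lie_br_sumr tensor1_sum; apply: eq_bigr => j _.
by rewrite lie_brZl lie_brZr !tensor1Z !mxE scalerA.
Qed.

Lemma completion_jacobi u v w :
  completion_bracket u (completion_bracket v w)
    + completion_bracket v (completion_bracket w u)
    + completion_bracket w (completion_bracket u v) = 0.
Proof.
pose br := completion_bracket.
have brl a x x' y : br (a *: x + x') y = a *: br x y + br x' y.
  exact: completion_linearl.
have brr a x y y' : br x (a *: y + y') = a *: br x y + br x y'.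
  exact: completion_linearr.
have bl0 y : br 0 y = 0.
  by have := brl (-1) 0 0 y; rewrite !scaleN1r oppr0 addr0 addNr.
have br0 x : br x 0 = 0.
  by have := brr (-1) x 0 0; rewrite !scaleN1r oppr0 addr0 addNr.
pose J u v w := br u (br v w) + br v (br w u) + br w (br u v).
have JC x y z : J x y z = J y z x by rewrite /J [RHS]addrC addrA.
have J0 y z : J 0 y z = 0 by rewrite /J !(bl0, br0) !addr0.
have JL a x x' y z : J (a *: x + x') y z = a *: J x y z + J x' y z.
  rewrite /J !(brl, brr) [X in X + _ = _]addrACA [LHS]addrACA.
  by rewrite !scalerDr.
have Jsum x y z :
    (forall i, J (delta_mx 0 i) y z = 0) -> J x y z = 0.
  move=> Jd; rewrite (row_sum_delta x).
  elim/big_rec: _ => [|i x' _ IH]; first exact: J0.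
  by rewrite JL Jd IH scaler0 addr0.
rewrite -/(J u v w); apply: (Jsum _ _ _) => i; rewrite JC; apply: (Jsum _ _ _) => j.
rewrite JC; apply: (Jsum _ _ _) => k; rewrite -!tensor1_basis /J /br -!tensor1_bracket.
by rewrite -!tensor1D lie_jacobi tensor10.
Qed.

Definition real_completion : lieAlgebra R :=
  @LieAlgebra R 'rV[R]_d completion_bracket completion_linearl
    completion_linearr completion_alternating completion_jacobi.

End RealCompletion.

(* Any real Lie algebra h that contains g as a rational Lie subalgebra in such
   a way that some rational basis of g is a real basis of h is (isomorphic to)
   the real completion of g. *)
Lemma real_completionP (R : realType) (g : lieAlgebra rat) (h : lieAlgebra R)
    (iota : g -> h) (b : (\dim {: lie_carrier g}).-tuple (lie_carrier g)) :
    (forall a x y, iota (a *: x + y) = ratr a *: iota x + iota y) ->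
    (forall x y, iota (lie_bracket x y) = lie_bracket (iota x) (iota y)) ->
    basis_of {: lie_carrier g} b ->
    basis_of {: lie_carrier h} (map iota b) ->
  lie_isomorphic (real_completion R g) h.
Proof.
move=> iotaZD iota_br b_basis ib_basis.
pose e := vbasis {: lie_carrier g}.
have iotaD x y : iota (x + y) = iota x + iota y.
  by have := iotaZD 1 x y; rewrite rmorph1 !scale1r.
have iota0 : iota 0 = 0.
  by have := iotaZD (-1) 0 0; rewrite rmorphN1 !scaleN1r oppr0 addr0 addNr.
have iotaZ a x : iota (a *: x) = ratr a *: iota x.
  by have := iotaZD a x 0; rewrite iota0 !addr0.
have iota_sum I (r : seq I) (x : I -> g) :
    iota (\sum_(i <- r) x i) = \sum_(i <- r) iota (x i).
  by elim/big_rec2: _ => [|i y z _ <-].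
pose f (u : real_completion R g) : h := \sum_i (u : 'rV_ _) 0 i *: iota e`_i.
have f_lin : linear f.
  move=> a u v; rewrite /f scaler_sumr -big_split; apply: eq_bigr => i _ /=.
  by rewrite !mxE scalerDl scalerA.
have f_add : {morph f : u v / u + v}.
  by move=> u v; have := f_lin 1 u v; rewrite !scale1r.
have f0 : f 0 = 0.
  by have := f_lin (-1) 0 0; rewrite !scaleN1r oppr0 addr0 addNr.
have fZ a u : f (a *: u) = a *: f u.
  by have := f_lin a u 0; rewrite f0 !addr0.
have f_sum I (r : seq I) (u : I -> real_completion R g) :
    f (\sum_(i <- r) u i) = \sum_(i <- r) f (u i).
  by elim/big_rec2: _ => [|i y z _ <-].
have f_tensor1 x : f (tensor1 R x) = iota x.
  rewrite {2}(coord_vbasis (memvf x)) iota_sum; apply: eq_bigr => i _.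
  by rewrite iotaZ !mxE.
pose fL := GRing.isLinear.Build _ _ _ _ f f_lin.
pose F : {linear _ -> _} := HB.pack f fL.
have FE u : linfun F u = f u by rewrite lfunE.
have F_full : limg (linfun F) = fullv.
  apply/eqP; rewrite eqEsubv subvf /= -(span_basis ib_basis).
  apply/span_subvP => _ /mapP[x _ ->].
  by rewrite -f_tensor1 -FE memv_img ?memvf.
have F_ker : lker (linfun F) == 0%VS.
  have dim_h : \dim {: lie_carrier h} = \dim {: lie_carrier g}.
    have ibE : basis_of {: lie_carrier h} (map_tuple iota b) by [].
    exact: size_basis ibE.
  have := limg_ker_dim (linfun F) fullv.
  rewrite F_full capfv dim_h [RHS]dimvf /dim /= mul1n => /eqP.
  by rewrite -[X in _ == X]add0n eqn_add2r dimv_eq0.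
exists (linfun F); split.
  exists (linfun F)^-1%VF; first exact: lker0_lfunK.
  by move=> y; rewrite limg_lfunVK // F_full memvf.
move=> u v; rewrite !FE /= /completion_bracket f_sum.
rewrite [in RHS]/f lie_br_suml; apply: eq_bigr => i _.
rewrite f_sum lie_br_sumr; apply: eq_bigr => j _.
by rewrite lie_brZl lie_brZr scalerA -iota_br -f_tensor1 fZ.
Qed.

Section Anosov.
Variables (R : realType) (g : lieAlgebra rat).
Local Notation d := (\dim {: lie_carrier g}).

(* The matrices [mxof] act on row vectors, so they are the transposes of the
   usual ones; this affects neither eigenvalues nor membership in GL(d, Z). *)
Definition complex_eigenvalue (A : 'End(lie_carrier g)) (z : R[i]) : bool :=
  let e := vbasis {: lie_carrier g} in
  eigenvalue (map_mx ratr (mxof e e A) : 'M[R[i]]_d) z.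

Definition hyperbolic (A : 'End(lie_carrier g)) :=
  forall z : R[i], complex_eigenvalue A z -> `|z| != 1.

Definition in_GLZ n (M : 'M[rat]_n) :=
  exists2 N : 'M[int]_n, N \in unitmx & M = map_mx intr N.

Definition anosov :=
  exists (A : 'End(lie_carrier g)) (b : d.-tuple (lie_carrier g)),
    [/\ lie_automorphism A, hyperbolic A, basis_of {: lie_carrier g} b
      & in_GLZ (mxof b b A)].

(* The eigenvalues may be computed in any basis. *)
Lemma complex_eigenvalueE (b : d.-tuple (lie_carrier g)) A z :
    basis_of {: lie_carrier g} b ->
  complex_eigenvalue A z
    = eigenvalue (map_mx ratr (mxof b b A) : 'M[R[i]]_d) z.
Proof.
move=> b_basis; rewrite /complex_eigenvalue.
have sub (b1 b2 : d.-tuple (lie_carrier g)) :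
    basis_of {: lie_carrier g} b1 -> basis_of {: lie_carrier g} b2 ->
    eigenvalue (map_mx ratr (mxof b1 b1 A) : 'M[R[i]]_d) z ->
  eigenvalue (map_mx ratr (mxof b2 b2 A) : 'M[R[i]]_d) z.
  move=> B1 B2 /eigenvalueP[v vA v0].
  pose P : 'M[R[i]]_d := map_mx ratr (mxof b1 b2 \1%VF).
  pose Q : 'M[R[i]]_d := map_mx ratr (mxof b2 b1 \1%VF).
  have PQ : P *m Q = 1%:M.
    rewrite -map_mxM -(mxof_comp _ _ B2) comp_lfun1l.
    by rewrite mxof1 ?(basis_free B1) // map_mx1.
  apply/eigenvalueP; exists (v *m P).
    rewrite -mulmxA -map_mxM -(mxof_comp _ _ B2) comp_lfun1r -[in LHS](comp_lfun1l A).
    by rewrite (mxof_comp _ _ B1) map_mxM mulmxA vA -scalemxAl.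
  apply: contra_neq v0 => vP0.
  by rewrite -[v]mulmx1 -PQ mulmxA vP0 mul0mx.
apply/idP/idP; apply: sub => //; exact: vbasisP.
Qed.

End Anosov.

(* Main.v *)
From HB Require Import structures.
Require Import Defs.
From mathcomp Require Import all_boot all_order all_algebra.
From mathcomp Require Import reals complex ring lra.

Set Implicit Arguments.
Unset Strict Implicit.
Unset Printing Implicit Defensive.

Import Order.TTheory GRing.Theory Num.Theory.
Import passmx.
Local Open Scope ring_scope.

(** A traceless 3 x 3 matrix B gives a 7-dimensional Lie algebra
    V + V' + F with V = F^3 in degree 1, V' = F^3 in degree 2 and F in
    degree 3: the bracket V x V -> V' is the cross product, and v in V brackets
    with xi in V' to the scalar product xi . (B v).  Then
    [x, [y, z]] = det (B x, y, z), so the Jacobi identity is tr B = 0.  For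
    B = diag (1, t, -(1+t)) this is [nil7_bracket t], here called m_t.

    The algebra [quad_lie rat t] is m_t with scalars extended to
    K = Q[w]/(w^2 - 3 w + 1) and regarded over Q, of dimension 14.  Since m_t
    is graded in degrees 1, 2, 3 and w is a unit of Z[w], multiplication by w^k
    in degree k is an automorphism preserving a lattice together with its
    inverse.  It is annihilated by the product of the polynomials x^2 - n x + 1
    for n = 3, 7, 18, the minimal polynomials of w, w^2 and w^3, whose roots
    are off the unit circle; hence the algebra is Anosov
    ([anosov_quad_lie]).

    Over the reals K splits, and the completion is the direct product m_t x m_t
    ([completion_quad_lie]).  An isomorphism m_t x m_t -> m_s x m_s respects
    the triple bracket, which on each factor is the form det (B x, y, z).
    Because that form is nondegenerate in x, each coordinate of the triple
    bracket of the target can only involve one factor of the source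
    ([prod_iso_form]).  This makes B_s conjugate to a multiple k B_t of B_t,
    so tr B_s^2 = k^2 tr B_t^2 and tr B_s^3 = k^3 tr B_t^3 ([form_trace]).
    Eliminating k, the number (u+1)^3 / u^2 with u = t^2 + t is an invariant,
    and it determines t among the integers t >= 2 ([form_invariant_inj]). *)

(** * The seven-dimensional family and its two doubles *)

Local Notation o k := (@Ordinal 7 k isT).

Lemma ord2_ind (P : 'I_2 -> Prop) : P 0 -> P 1 -> forall i, P i.
Proof.
by move=> P0 P1 [[|[|k]] // lt_k]; [move: P0 | move: P1];
  congr (P _); apply: val_inj.
Qed.

Lemma ord3_ind (P : 'I_3 -> Prop) : P 0 -> P 1 -> P 2%:R -> forall i, P i.
Proof.
by move=> P0 P1 P2 [[|[|[|k]]] // lt_k]; [move: P0 | move: P1 | move: P2];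
  congr (P _); apply: val_inj.
Qed.

Lemma ord7_ind (P : 'I_7 -> Prop) :
    P (o 0) -> P (o 1) -> P (o 2) -> P (o 3) -> P (o 4) -> P (o 5) -> P (o 6) ->
  forall k, P k.
Proof.
move=> P0 P1 P2 P3 P4 P5 P6 [k lt_k].
by move: k lt_k => [|[|[|[|[|[|[|k]]]]]]] // lt_k;
  rewrite (bool_irrelevance lt_k isT).
Qed.

Section Family.
Variables (F : fieldType) (t : nat).
Implicit Types (x y : 'I_7 -> F) (X Y Z : 'M[F]_(2, 7)).

(** Coordinates 0-2 span V, 3-5 span V', 6 is degree 3.  Arguments are
    coordinate functions so that rows of a matrix can be passed directly. *)
Definition nil7_bracket x y (k : 'I_7) : F :=
  [:: 0; 0; 0;
      x (o 1) * y (o 2) - x (o 2) * y (o 1);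
      x (o 2) * y (o 0) - x (o 0) * y (o 2);
      x (o 0) * y (o 1) - x (o 1) * y (o 0);
      (x (o 0) * y (o 3) - y (o 0) * x (o 3))
        + t%:R * (x (o 1) * y (o 4) - y (o 1) * x (o 4))
        - (1 + t%:R) * (x (o 2) * y (o 5) - y (o 2) * x (o 5))]`_k.

(** The rows of X are a and b in the element a + b w of the extension of m_t
    by w with w^2 = 3 w - 1. *)
Definition quad_bracket X Y : 'M[F]_(2, 7) := \matrix_(i, k)
  if i == 0 then nil7_bracket (X 0) (Y 0) k - nil7_bracket (X 1) (Y 1) k
  else nil7_bracket (X 0) (Y 1) k + nil7_bracket (X 1) (Y 0) k
         + 3%:R * nil7_bracket (X 1) (Y 1) k.

Definition prod_bracket X Y : 'M[F]_(2, 7) :=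
  \matrix_(i, k) nil7_bracket (X i) (Y i) k.

Lemma quad_linearl Y : linear (quad_bracket^~ Y).
Proof.
move=> a X Z; apply/matrixP.
by elim/ord2_ind; elim/ord7_ind; rewrite !mxE /= /nil7_bracket /= ?mxE; ring.
Qed.

Lemma quad_linearr X : linear (quad_bracket X).
Proof.
move=> a Y Z; apply/matrixP.
by elim/ord2_ind; elim/ord7_ind; rewrite !mxE /= /nil7_bracket /= ?mxE; ring.
Qed.

Lemma quad_alternating X : quad_bracket X X = 0.
Proof.
apply/matrixP.
by elim/ord2_ind; elim/ord7_ind; rewrite !mxE /= /nil7_bracket /= ?mxE; ring.
Qed.

(** The identity holds in coordinate 6 because 1 + t - (1 + t) = 0; elsewhere
    each iterated bracket vanishes. *)
Lemma quad_jacobi X Y Z :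
  quad_bracket X (quad_bracket Y Z) + quad_bracket Y (quad_bracket Z X)
    + quad_bracket Z (quad_bracket X Y) = 0.
Proof.
apply/matrixP.
by elim/ord2_ind; elim/ord7_ind; rewrite !mxE /= /nil7_bracket /= ?mxE /=
  /nil7_bracket /=; ring.
Qed.

Definition quad_lie : lieAlgebra F :=
  @LieAlgebra F 'M[F]_(2, 7) quad_bracket quad_linearl quad_linearr
    quad_alternating quad_jacobi.

Lemma prod_linearl Y : linear (prod_bracket^~ Y).
Proof.
move=> a X Z; apply/matrixP => i.
by elim/ord7_ind; rewrite !mxE /nil7_bracket /= ?mxE; ring.
Qed.

Lemma prod_linearr X : linear (prod_bracket X).
Proof.
move=> a Y Z; apply/matrixP => i.
by elim/ord7_ind; rewrite !mxE /nil7_bracket /= ?mxE; ring.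
Qed.

Lemma prod_alternating X : prod_bracket X X = 0.
Proof.
by apply/matrixP => i; elim/ord7_ind; rewrite !mxE /nil7_bracket /= ?mxE; ring.
Qed.

Lemma prod_jacobi X Y Z :
  prod_bracket X (prod_bracket Y Z) + prod_bracket Y (prod_bracket Z X)
    + prod_bracket Z (prod_bracket X Y) = 0.
Proof.
apply/matrixP => i.
by elim/ord7_ind; rewrite !mxE /nil7_bracket /= ?mxE /nil7_bracket /=; ring.
Qed.

Definition prod_lie : lieAlgebra F :=
  @LieAlgebra F 'M[F]_(2, 7) prod_bracket prod_linearl prod_linearr
    prod_alternating prod_jacobi.

End Family.

(** * The real completion is a direct product *)

Lemma lie_isomorphic_sym (F : fieldType) (g h : lieAlgebra F) :
  lie_isomorphic g h -> lie_isomorphic h g.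
Proof.
case=> f [f_bij f_mor]; have kf : lker f == 0%VS.
  by apply/lker0P; apply: bij_inj.
have fK : cancel f (f^-1)%VF by apply: lker0_lfunK.
have Kf : cancel (f^-1)%VF f.
  by case: f_bij => f' _ Kf' y; rewrite -{1}(Kf' y) fK Kf'.
exists (f^-1)%VF; split; first by exists f.
by move=> x y; apply: (bij_inj f_bij); rewrite f_mor !Kf.
Qed.

Lemma lie_isomorphic_trans (F : fieldType) (g h k : lieAlgebra F) :
  lie_isomorphic g h -> lie_isomorphic h k -> lie_isomorphic g k.
Proof.
case=> f [f_bij f_mor] [f' [f'_bij f'_mor]]; exists (f' \o f)%VF; split.
  by apply: (eq_bij (bij_comp f'_bij f_bij)) => x; rewrite /= comp_lfunE.
by move=> x y; rewrite !comp_lfunE f_mor f'_mor.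
Qed.

Definition std_seq (F : fieldType) : seq 'M[F]_(2, 7) :=
  [seq delta_mx p.1 p.2 | p : 'I_2 * 'I_7].

Lemma size_std_seq (F : fieldType) : size (std_seq F) = 14.
Proof. by rewrite size_map -cardE card_prod !card_ord. Qed.

Lemma dim_mat (F : fieldType) : \dim {: 'M[F]_(2, 7)} = 14.
Proof. by rewrite dimvf. Qed.

(** With L the identity this is the standard basis; with L the matrix of the two
    embeddings of K it is the image of that basis in the direct product. *)
Lemma mulmx_basis (F : fieldType) (L : 'M[F]_2) :
  L \in unitmx -> basis_of {: 'M[F]_(2, 7)} [seq L *m X | X <- std_seq F].
Proof.
move=> uL; rewrite basisEdim size_map size_std_seq dim_mat leqnn andbT.
apply/subvP => X _; rewrite -[X](mulKVmx uL) [invmx L *m X]matrix_sum_delta.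
rewrite mulmx_sumr memv_suml // => i _; rewrite mulmx_sumr memv_suml // => k _.
rewrite -scalemxAr memvZ // memv_span // -map_comp.
by apply/mapP; exists (i, k); rewrite ?mem_enum.
Qed.

Lemma std_seq_basis (F : fieldType) : basis_of {: 'M[F]_(2, 7)} (std_seq F).
Proof.
have := mulmx_basis (unitmx1 F 2); congr (basis_of _ _).
by rewrite -[RHS]map_id; apply: eq_map => X; rewrite mul1mx.
Qed.

Section Completion.
Variable R : realType.

(** The two roots of x^2 - 3 x + 1, images of w under the embeddings of K. *)
Definition eps_plus : R := (3%:R + Num.sqrt 5%:R) / 2%:R.
Definition eps_minus : R := (3%:R - Num.sqrt 5%:R) / 2%:R.

Lemma sqrt5 : Num.sqrt 5%:R ^+ 2 = 5%:R :> R.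
Proof. by rewrite sqr_sqrtr ?ler0n. Qed.

Lemma eps_plus_root : eps_plus ^+ 2 = 3%:R * eps_plus - 1.
Proof. by rewrite /eps_plus; field: sqrt5. Qed.

Lemma eps_minus_root : eps_minus ^+ 2 = 3%:R * eps_minus - 1.
Proof. by rewrite /eps_minus; field: sqrt5. Qed.

(** Row i is the i-th embedding of K on the basis (1, w), so that left
    multiplication maps the rows a, b to the two conjugates of a + b w. *)
Definition embeddings : 'M[R]_2 :=
  \matrix_(i, j) if j == 0 then 1 else if i == 0 then eps_plus else eps_minus.

Lemma embeddings_unit : embeddings \in unitmx.
Proof.
rewrite unitmxE unitfE (expand_det_row _ 0) !big_ord_recl big_ord0.
rewrite /cofactor !det_mx11 !mxE /= expr0 expr1 !mul1r mulr1 addr0.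
have : 0 < Num.sqrt 5%:R :> R by rewrite sqrtr_gt0 ltr0n.
by rewrite /eps_plus /eps_minus => H; apply/eqP; lra.
Qed.

Lemma completion_quad_lie t :
  lie_isomorphic (real_completion R (quad_lie rat t)) (prod_lie R t).
Proof.
have szb : size (std_seq rat) == \dim {: lie_carrier (quad_lie rat t)}.
  by rewrite size_std_seq dim_mat.
pose iota (X : quad_lie rat t) : prod_lie R t := embeddings *m map_mx ratr X.
apply: (@real_completionP R _ _ iota (Tuple szb)).
- move=> a X Y; rewrite /iota map_mxD map_mxZ mulmxDr -scalemxAr //.
- move=> X Y; apply/matrixP => i.
  (* Row i of iota X is a + l b, where l^2 = 3 l - 1 is the defining relation
     of w. *)
  have E0 : embeddings i 0 = 1 by rewrite mxE.
  have E1 : embeddings i 1 ^+ 2 = 3%:R * embeddings i 1 - 1.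
    by rewrite mxE /=; case: ifP => _; rewrite ?eps_plus_root ?eps_minus_root.
  have iotaE Z k : iota Z i k = ratr (Z 0 k) + embeddings i 1 * ratr (Z 1 k).
    have E2 : lift ord0 ord0 = 1 :> 'I_2 by apply: val_inj.
    by rewrite mxE !big_ord_recl big_ord0 E2 E0 !mxE mul1r addr0.
  move: (embeddings i 1) E1 iotaE => l El iotaE k.
  rewrite iotaE !mxE /=; move: k.
  elim/ord7_ind; rewrite /nil7_bracket /= ?iotaE; ring: El.
- exact: std_seq_basis.
- have := mulmx_basis embeddings_unit; congr (basis_of _ _).
  rewrite /std_seq -!map_comp; apply: eq_map => p /=.
  by rewrite /iota map_delta_mx.
Qed.
End Completion.

(** * The Anosov automorphism *)

(** The matrices of A and of its inverse are then integral and mutually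
    inverse. *)
Lemma in_GLZ_integral (V : vectType rat) (b : (\dim {: V}).-tuple V)
    (A A' : 'End(V)) :
    basis_of {: V} b -> cancel A A' ->
    (forall i j : 'I_(\dim {: V}), coord b j (A b`_i) \is a Num.int) ->
    (forall i j : 'I_(\dim {: V}), coord b j (A' b`_i) \is a Num.int) ->
  in_GLZ (mxof b b A).
Proof.
move=> b_basis AK intA intA'.
pose N (f : 'End(V)) : 'M[int]_(\dim {: V}) := map_mx Num.floor (mxof b b f).
have NE (f : 'End(V)) :
    (forall i j : 'I_(\dim {: V}), coord b j (f b`_i) \is a Num.int) ->
    mxof b b f = map_mx intr (N f).
  move=> intf; apply/matrixP => i j.
  by rewrite !mxE /= vecof_delta floorK // intf.
exists (N A); last exact: NE.
suff NN : N A *m N A' = 1%:M by case: (mulmx1_unit NN).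
have NN : map_mx (intr : int -> rat) (N A *m N A') = map_mx intr 1%:M.
  rewrite map_mxM map_mx1 -!NE // -mxof_comp // -(mxof1 (basis_free b_basis)).
  by congr mxof; apply/lfunP => x; rewrite comp_lfunE lfunE /= AK.
apply/matrixP => i j; apply: (@intr_inj rat).
by have /matrixP/(_ i j) := NN; rewrite ![map_mx _ _ _ _]mxE.
Qed.

Section Hyperbolic.
Variable R : realType.

(** If |z| = 1 then n = |n z| = |z^2 + 1| <= 2. *)
Lemma quadratic_root_norm (n : nat) (z : R[i]) :
  (3 <= n)%N -> z ^+ 2 - n%:R * z + 1 = 0 -> `|z| != 1.
Proof.
move=> n3 zE; apply/eqP => nz.
have E : n%:R * z = z ^+ 2 + 1 by rewrite -[RHS]subr0 -zE; ring.
have : `|n%:R * z| <= 2%:R.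
  rewrite E; apply: le_trans (ler_normD _ _) _.
  by rewrite normrX nz expr1n normr1.
by rewrite normrM nz mulr1 normr_nat ler_nat leqNgt n3.
Qed.

Definition quadratic (V : vectType rat) (A : 'End(V)) (n : nat) : 'End(V) :=
  (A \o A - n%:R *: A + \1)%VF.

(** On an eigenvector for z, the three factors act as the scalars
    z^2 - n z + 1, so one of these vanishes. *)
Lemma hyperbolic_annihilated (g : lieAlgebra rat) (A : 'End(lie_carrier g))
    (n1 n2 n3 : nat) :
    (3 <= n1)%N -> (3 <= n2)%N -> (3 <= n3)%N ->
    (quadratic A n3 \o quadratic A n2 \o quadratic A n1)%VF = 0 ->
  hyperbolic R A.
Proof.
move=> n1_3 n2_3 n3_3 A0 z /eigenvalueP[v vA v0].
pose e := vbasis {: lie_carrier g}.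
have be : basis_of {: lie_carrier g} e by exact: vbasisP.
have vq n : v *m map_mx ratr (mxof e e (quadratic A n))
    = (z ^+ 2 - n%:R * z + 1) *: v.
  rewrite /quadratic linearD linearB linearZ /= (mxof_comp _ _ be).
  rewrite (mxof1 (basis_free be)).
  rewrite map_mxD map_mxB map_mxZ map_mxM map_mx1 rmorph_nat.
  rewrite mulmxDr mulmxBr -scalemxAr mulmxA vA -scalemxAl vA mulmx1 !scalerA.
  by rewrite -[v in X in _ + X = _]scale1r -scalerBl -scalerDl.
have := congr1 (fun M => v *m map_mx ratr (mxof e e M)) A0.
rewrite /= !(mxof_comp _ _ be) !map_mxM !mulmxA vq.
rewrite -!scalemxAl vq -!scalemxAl vq !scalerA.
rewrite linear0 map_mx0 mulmx0 => /eqP.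
rewrite scaler_eq0 (negPf v0) orbF !mulf_eq0.
by case/orP => [/orP[]|] /eqP; apply: quadratic_root_norm.
Qed.
End Hyperbolic.

Section Dilation.
(** Multiplication of the k-th coordinate by the element p k + q k w of K. *)
Definition scaling (p q : 'I_7 -> rat) (X : 'M[rat]_(2, 7)) : 'M[rat]_(2, 7) :=
  \matrix_(i, k) if i == 0 then p k * X 0 k - q k * X 1 k
                 else q k * X 0 k + (p k + 3%:R * q k) * X 1 k.

Lemma scaling_linear p q : linear (scaling p q).
Proof.
by move=> a X Y; apply/matrixP; elim/ord2_ind => k; rewrite !mxE /=; ring.
Qed.
HB.instance Definition _ p q := GRing.isSemilinear.Build rat _ _ _ (scaling p q)
  (GRing.semilinear_linear (scaling_linear p q)).

Lemma scaling_integral p q (b : (\dim {: 'M[rat]_(2, 7)}).-tuple 'M[rat]_(2, 7))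
    (i j : 'I_(\dim {: 'M[rat]_(2, 7)})) :
    b = std_seq rat :> seq _ ->
    (forall k, p k \is a Num.int) -> (forall k, q k \is a Num.int) ->
  coord b j (linfun (scaling p q) b`_i) \is a Num.int.
Proof.
move=> bE ip iq.
have b_basis : basis_of {: 'M[rat]_(2, 7)} b by rewrite bE std_seq_basis.
have int_coord (X : 'M[rat]_(2, 7)) :
    (forall i k, X i k \is a Num.int) -> coord b j X \is a Num.int.
  move=> iX; rewrite [X]matrix_sum_delta linear_sum rpred_sum // => k _.
  rewrite linear_sum rpred_sum // => l _; rewrite linearZ /= rpredM //.
  have : delta_mx k l \in tval b.
    by rewrite bE; apply/mapP; exists (k, l); rewrite ?mem_enum.
  case/(nthP 0) => m; rewrite size_tuple => lt_m <-.
  by rewrite (coord_free (Ordinal lt_m) j (basis_free b_basis)) rpred_nat.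
apply: int_coord => k l; rewrite lfunE /=.
have : b`_i \in tval b by rewrite mem_nth ?size_tuple.
rewrite bE => /mapP[[k' l'] _ ->] /=; rewrite !mxE.
by case: ifP => _; rewrite ?(rpredB, rpredD, rpredM, ip, iq, rpred_nat).
Qed.

(** The powers w, w^2 = -1 + 3 w and w^3 = -3 + 8 w, in degrees 1, 2, 3. *)
Definition unit_re (k : 'I_7) : rat := [:: 0; 0; 0; -1; -1; -1; - 3%:R]`_k.
Definition unit_im (k : 'I_7) : rat := [:: 1; 1; 1; 3%:R; 3%:R; 3%:R; 8%:R]`_k.

(** The hypothesis says that u = p k + q k w has norm 1; its trace is
    T = 2 p k + 3 q k, so u^2 - n u + 1 = (T - n) u. *)
Lemma quadratic_scaling p q n X :
    (forall k, p k ^+ 2 = 1 - 3%:R * p k * q k - q k ^+ 2) ->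
  quadratic (linfun (scaling p q)) n X
    = scaling (fun k => (2%:R * p k + 3%:R * q k - n%:R) * p k)
              (fun k => (2%:R * p k + 3%:R * q k - n%:R) * q k) X.
Proof.
move=> uE; rewrite /quadratic.
rewrite !(add_lfunE, opp_lfunE, scale_lfunE, comp_lfunE, id_lfunE).
rewrite !lfunE /=; apply/matrixP.
by elim/ord2_ind => k; rewrite !mxE /= ?mxE; ring: (uE k).
Qed.

Lemma anosov_quad_lie (R : realType) t : anosov R (quad_lie rat t).
Proof.
pose p := unit_re; pose q := unit_im.
(* The inverse of a unit of norm 1 is its conjugate (p + 3 q) - q w. *)
pose p' k := p k + 3%:R * q k; pose q' k := - q k.
have ip k : p k \is a Num.int by move: k; elim/ord7_ind.
have iq k : q k \is a Num.int by move: k; elim/ord7_ind.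
have szb : size (std_seq rat) == \dim {: lie_carrier (quad_lie rat t)}.
  by rewrite size_std_seq dim_mat.
pose A : 'End(lie_carrier (quad_lie rat t)) := linfun (scaling p q).
pose A' : 'End(lie_carrier (quad_lie rat t)) := linfun (scaling p' q').
have AK : cancel A A'.
  move=> X; rewrite !lfunE /=; apply/matrixP.
  elim/ord2_ind; elim/ord7_ind;
    rewrite !mxE /= ?mxE /p' /q' /p /q /unit_re /unit_im /=; ring.
have A'K : cancel A' A.
  move=> X; rewrite !lfunE /=; apply/matrixP.
  elim/ord2_ind; elim/ord7_ind;
    rewrite !mxE /= ?mxE /p' /q' /p /q /unit_re /unit_im /=; ring.
exists A, (Tuple szb); split.
- split; first by exists A'.
  move=> X Y; rewrite !lfunE /=; apply/matrixP.
  elim/ord2_ind; elim/ord7_ind;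
    rewrite !mxE /= /nil7_bracket /= ?mxE /p /q /unit_re /unit_im /=; ring.
(* 3, 7 and 18 are the traces of w, w^2 and w^3. *)
- apply: (@hyperbolic_annihilated _ _ _ 3 7 18) => //.
  apply/lfunP => X; rewrite !comp_lfunE [RHS]lfunE.
  have uE k : p k ^+ 2 = 1 - 3%:R * p k * q k - q k ^+ 2.
    by move: k; elim/ord7_ind; rewrite /p /q /unit_re /unit_im /=; ring.
  rewrite !(quadratic_scaling _ _ uE); apply/matrixP.
  elim/ord2_ind; elim/ord7_ind;
    rewrite !mxE /= ?mxE /= ?mxE /p /q /unit_re /unit_im /=; ring.
- exact: std_seq_basis.
- apply: (@in_GLZ_integral _ _ A A') => [|//|i j|i j]; first exact: std_seq_basis.
    exact: scaling_integral.
  apply: scaling_integral => // k.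
    by rewrite rpredD ?rpredM ?rpred_nat.
  by rewrite rpredN.
Qed.
End Dilation.

(** * An isomorphism invariant of the direct products *)

Section Triple.
Variable F : fieldType.
Implicit Types (x y z : 'rV[F]_3) (M : 'M[F]_3).

Definition det3 x y z : F := \det (\matrix_(i < 3) [:: x; y; z]`_i).

Lemma det3E x y z : det3 x y z =
  x 0 0 * (y 0 1 * z 0 2%:R - y 0 2%:R * z 0 1)
  + x 0 1 * (y 0 2%:R * z 0 0 - y 0 0 * z 0 2%:R)
  + x 0 2%:R * (y 0 0 * z 0 1 - y 0 1 * z 0 0).
Proof.
pose coef (u : 'rV[F]_3) (n : nat) := u 0 (inord n).
have coefE (u : 'rV[F]_3) i : u 0 i = coef u i by rewrite /coef inord_val.
rewrite /det3 (expand_det_row _ ord0) !big_ord_recl big_ord0 /cofactor.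
rewrite !(expand_det_row _ ord0) !big_ord_recl !big_ord0 /cofactor !det_mx11.
by rewrite !mxE /= !coefE /= /bump /=; ring.
Qed.

Lemma det3_linearl a x x' y z :
  det3 (a *: x + x') y z = a * det3 x y z + det3 x' y z.
Proof. by rewrite !det3E !mxE; ring. Qed.

Lemma det30l y z : det3 0 y z = 0.
Proof. by rewrite det3E !mxE; ring. Qed.

Lemma det30m x z : det3 x 0 z = 0.
Proof. by rewrite det3E !mxE; ring. Qed.

Lemma det3_mulmx x y z M : det3 (x *m M) (y *m M) (z *m M) = det3 x y z * \det M.
Proof.
rewrite /det3 -det_mulmx; congr (\det _); apply/row_matrixP => i.
by rewrite row_mul !rowK; case: i => [[|[|[|i]]] // lt_i].
Qed.

Lemma det3_nondegenerate x : (forall y z, det3 x y z = 0) -> x = 0.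
Proof.
move=> x0; apply/rowP; pose e i : 'rV[F]_3 := delta_mx 0 i.
by elim/ord3_ind; [have := x0 (e 1) (e 2%:R) | have := x0 (e 2%:R) (e 0)
  | have := x0 (e 0) (e 1)]; rewrite det3E !mxE /= => <-; ring.
Qed.

End Triple.

Section Invariant.
Variable R : realFieldType.
Implicit Types (t s : nat) (X Y Z : 'M[R]_(2, 7)).

(** The traceless matrix defining m_t, called B_t below. *)
Definition form_mx t : 'M[R]_3 :=
  diag_mx (\row_i [:: 1; t%:R; - (1 + t%:R)]`_i).

Definition gens (i : 'I_2) X : 'rV[R]_3 :=
  \row_a X i (widen_ord (isT : (3 <= 7)%N) a).

Lemma gens_linear i : linear (gens i).
Proof. by move=> a X Y; apply/rowP => k; rewrite !mxE. Qed.
HB.instance Definition _ i := GRing.isSemilinear.Build R _ _ _ (gens i)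
  (GRing.semilinear_linear (gens_linear i)).

Definition of_gens (j : 'I_2) (v : 'rV[R]_3) : 'M[R]_(2, 7) :=
  \matrix_(i, k) if i == j then [:: v 0 0; v 0 1; v 0 2%:R]`_k else 0.

Lemma of_gens_linear j : linear (of_gens j).
Proof.
move=> a u v; apply/matrixP => i; elim/ord7_ind; rewrite !mxE /= ?mxE;
  by case: eqP => _; ring.
Qed.
HB.instance Definition _ j := GRing.isSemilinear.Build R _ _ _ (of_gens j)
  (GRing.semilinear_linear (of_gens_linear j)).

Lemma of_gensK i j v : gens i (of_gens j v) = if i == j then v else 0.
Proof.
by apply/rowP; elim/ord3_ind; rewrite !mxE /=; case: eqP => _; rewrite ?mxE.
Qed.

Lemma gensE i X : [/\ gens i X 0 0 = X i (o 0), gens i X 0 1 = X i (o 1)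
  & gens i X 0 2%:R = X i (o 2)].
Proof. by split; rewrite mxE; congr (X i _); apply: val_inj. Qed.

Lemma form_mulE t (x : 'rV[R]_3) a :
  (x *m form_mx t) 0 a = x 0 a * [:: 1; t%:R; - (1 + t%:R)]`_a.
Proof. by rewrite mul_mx_diag !mxE. Qed.

Lemma prod_bracket3 t X Y Z : prod_bracket t X (prod_bracket t Y Z)
  = \sum_j det3 (gens j X *m form_mx t) (gens j Y) (gens j Z) *: delta_mx j (o 6).
Proof.
apply/matrixP => i k; rewrite summxE (bigD1 i) //= big1 ?addr0; last first.
  by move=> j /negPf ji; rewrite !mxE [i == j]eq_sym ji mulr0.
rewrite [RHS]mxE [delta_mx _ _ _ _]mxE eqxx det3E !form_mulE /=.
have [-> -> ->] := gensE i X; have [-> -> ->] := gensE i Y.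
have [-> -> ->] := gensE i Z; rewrite mxE.
move: k; elim/ord7_ind; rewrite /= /nil7_bracket /= ?mxE /nil7_bracket /=; ring.
Qed.

Lemma form_mx_inj t (x : 'rV[R]_3) : (0 < t)%N -> x *m form_mx t = 0 -> x = 0.
Proof.
move=> t0 /rowP x0; apply/rowP => i; have := x0 i; rewrite form_mulE mxE.
have t1 : t%:R != 0 :> R by rewrite pnatr_eq0 -lt0n.
have t2 : - (1 + t%:R) != 0 :> R by rewrite oppr_eq0 -mulrS pnatr_eq0.
by move: i; elim/ord3_ind => /= /eqP; rewrite ?mulr1 ?mulf_eq0 ?(negPf t1)
   ?(negPf t2) ?orbF => /eqP.
Qed.

Lemma form_det3_nondegenerate t (x : 'rV[R]_3) : (0 < t)%N ->
  (forall y z, det3 (x *m form_mx t) y z = 0) -> x = 0.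
Proof. by move=> t0 /det3_nondegenerate; apply: form_mx_inj. Qed.

(** Write T_i for the triple form of the i-th factor.  Transporting T_0 of the
    target along f gives chi 0 T_0 + chi 1 T_1 on the source.  Not both
    coefficients vanish since f is onto.  If neither did, the preimage x of a
    generator w of the second factor would be in the kernel of T_0 and T_1,
    because T_0 (w, _, _) = 0; then [x, [_, _]] = 0, although
    [w, [_, _]] <> 0.  So exactly one T_j survives, and restricting to the
    generators of the j-th factor gives M. *)
Lemma prod_iso_form t s : (0 < t)%N -> (0 < s)%N ->
    lie_isomorphic (prod_lie R t) (prod_lie R s) ->
  exists (c : R) (M : 'M[R]_3), c != 0 /\ forall x y z,
    det3 (x *m M *m form_mx s) (y *m M) (z *m M) = c * det3 (x *m form_mx t) y z.
Proof.
move=> t0 s0 [f [[f' fK f'K] f_mor]].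
pose chi j : R := f (delta_mx j (o 6) : 'M[R]_(2, 7)) 0 (o 6).
have f3 X Y Z : f (prod_bracket t X (prod_bracket t Y Z))
    = prod_bracket s (f X) (prod_bracket s (f Y) (f Z)).
  by rewrite -[RHS]/(lie_bracket (f X) (lie_bracket (f Y) (f Z))) -!f_mor.
have main X Y Z : det3 (gens 0 (f X) *m form_mx s) (gens 0 (f Y)) (gens 0 (f Z))
    = \sum_j det3 (gens j X *m form_mx t) (gens j Y) (gens j Z) * chi j.
  have := f3 X Y Z; rewrite !prod_bracket3.
  move/(congr1 (fun U : 'M[R]_(2, 7) => U 0 (o 6))).
  rewrite linear_sum !summxE [RHS](bigD1 0) //= [X in _ + X]big1 ?addr0.
    rewrite [RHS]mxE [delta_mx _ _ _ _]mxE /= mulr1 => <-.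
    by apply: eq_bigr => j _; rewrite linearZ mxE.
  by move=> j j0; rewrite mxE [delta_mx _ _ _ _]mxE eq_sym (negPf j0) mulr0.
have [j [chi_j chi_j']] : exists j, chi j != 0 /\ forall i, i != j -> chi i = 0.
  have [c0|c0] := eqVneq (chi 0) 0; have [c1|c1] := eqVneq (chi 1) 0.
  - have e0 : (delta_mx 0 0 : 'rV[R]_3) = 0.
      apply: (form_det3_nondegenerate s0) => y z.
      have := main (f' (of_gens 0 (delta_mx 0 0)))
        (f' (of_gens 0 y)) (f' (of_gens 0 z)).
      rewrite !f'K !of_gensK /= => ->.
      rewrite big1 // => i _; move: i; elim/ord2_ind; rewrite ?c0 ?c1 mulr0 //.
    by have /rowP/(_ 0) := e0; rewrite !mxE => /eqP; rewrite oner_eq0.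
  - by exists 1; split=> //; elim/ord2_ind.
  - by exists 0; split=> //; elim/ord2_ind.
  - have c_neq0 i : chi i != 0 by move: i; elim/ord2_ind.
    pose w := of_gens 1 (delta_mx 0 0); pose x := f' w.
    have x0 i : gens i x = 0.
      apply: (form_det3_nondegenerate t0) => y z.
      have := main x (of_gens i y) (of_gens i z); rewrite f'K of_gensK /=.
      rewrite mul0mx det30l (bigD1 i) //= big1 ?addr0 ?of_gensK ?eqxx.
        by move/esym/eqP; rewrite mulf_eq0 (negPf (c_neq0 i)) orbF => /eqP.
      by move=> k ki; rewrite !of_gensK (negPf ki) det30m mul0r.
    have xYZ Y Z : prod_bracket t x (prod_bracket t Y Z) = 0.
      by rewrite prod_bracket3 big1 // => i _; rewrite x0 mul0mx det30l scale0r.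
    have e0 : (delta_mx 0 0 : 'rV[R]_3) = 0.
      apply: (form_det3_nondegenerate s0) => y z.
      have := f3 x (f' (of_gens 1 y)) (f' (of_gens 1 z)).
      rewrite xYZ linear0 !f'K prod_bracket3.
      move/(congr1 (fun U : 'M[R]_(2, 7) => U 1 (o 6))).
      rewrite summxE (bigD1 1) //= big1 ?addr0.
        by rewrite !of_gensK /= ![(_ : 'M__) 1 _]mxE /= mulr1 => <-.
      by move=> i i1; rewrite ![(_ : 'M__) 1 _]mxE eq_sym (negPf i1) mulr0.
    by have /rowP/(_ 0) := e0; rewrite !mxE => /eqP; rewrite oner_eq0.
exists (chi j), (lin1_mx (gens 0 \o f \o of_gens j)); split=> // x y z.
rewrite !mul_rV_lin1 /= main (bigD1 j) //= big1 ?addr0.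
  by rewrite !of_gensK eqxx mulrC.
by move=> i ij; rewrite chi_j' ?mulr0.
Qed.

(** Moving M out of the determinant turns the hypothesis into
    det (x N, y, z) det M = c det (x B_t, y, z) with N = M B_s M^-1, that is,
    N = (c / det M) B_t. *)
Lemma form_trace t s (c : R) (M : 'M[R]_3) : (0 < t)%N -> c != 0 ->
    (forall x y z, det3 (x *m M *m form_mx s) (y *m M) (z *m M)
       = c * det3 (x *m form_mx t) y z) ->
  exists k : R,
    \tr (form_mx s *m form_mx s) = k ^+ 2 * \tr (form_mx t *m form_mx t) /\
    \tr (form_mx s *m form_mx s *m form_mx s)
      = k ^+ 3 * \tr (form_mx t *m form_mx t *m form_mx t).
Proof.
move=> t0 c0 H.
have uM : M \in unitmx.
  rewrite unitmxE unitfE; apply/negP => /det0P[v v0 vM]; case/negP: v0.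
  apply/eqP/(form_det3_nondegenerate t0) => y z; apply: (mulfI c0).
  by rewrite -H vM mul0mx det30l mulr0.
have dM : \det M != 0 by rewrite -unitfE -unitmxE.
pose N := M *m form_mx s *m invmx M.
have NE : N = (c / \det M) *: form_mx t.
  apply/row_matrixP => i; rewrite !rowE; set x := delta_mx 0 i.
  apply/eqP; rewrite -subr_eq0; apply/eqP/det3_nondegenerate => y z.
  have E := H x y z.
  have : det3 (x *m N) y z * \det M = c * det3 (x *m form_mx t) y z.
    by rewrite -det3_mulmx -E /N !mulmxA mulmxKV.
  move=> {}E; rewrite addrC -scalemxAr -scaleNr det3_linearl.
  by apply: (mulIf dM); rewrite mulrDl E mul0r; field.
exists (c / \det M).
have BE : form_mx s = invmx M *m N *m M by rewrite /N !mulmxA mulVmx // mul1mx mulmxKV.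
have N2 : form_mx s *m form_mx s = invmx M *m (N *m N) *m M.
  by rewrite BE !mulmxA mulmxK.
have N3 : form_mx s *m form_mx s *m form_mx s = invmx M *m (N *m N *m N) *m M.
  by rewrite N2 {1}BE !mulmxA mulmxK.
have trE (U : 'M[R]_3) : \tr (invmx M *m U *m M) = \tr U.
  by rewrite mxtrace_mulC mulmxA mulmxV // mul1mx.
rewrite N3 N2 !trE NE -!scalemxAl -!scalemxAr -?scalemxAl !mxtraceZ.
by split; ring.
Qed.

Lemma form_tr2 t : \tr (form_mx t *m form_mx t) = 2%:R * (t%:R ^+ 2 + t%:R + 1).
Proof.
rewrite /mxtrace !big_ord_recl big_ord0 /form_mx !mul_diag_mx !mxE /=; ring.
Qed.

Lemma form_tr3 t : \tr (form_mx t *m form_mx t *m form_mx t)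
  = - 3%:R * (t%:R ^+ 2 + t%:R).
Proof.
rewrite /mxtrace !big_ord_recl big_ord0 /form_mx -!mulmxA !mul_diag_mx !mxE /=; ring.
Qed.

(** With u = t^2 + t and v = s^2 + s, eliminating k gives
    (v+1)^3 u^2 = (u+1)^3 v^2.  The difference of the two sides has the factor
    v - u, and the cofactor is positive once u and v are at least 6. *)
Lemma form_invariant_inj t s (k : R) : (2 <= t)%N -> (2 <= s)%N ->
    s%:R ^+ 2 + s%:R + 1 = k ^+ 2 * (t%:R ^+ 2 + t%:R + 1) ->
    s%:R ^+ 2 + s%:R = k ^+ 3 * (t%:R ^+ 2 + t%:R) ->
  t = s.
Proof.
move=> t2 s2; have : 2%:R <= t%:R :> R by rewrite ler_nat.
have : 2%:R <= s%:R :> R by rewrite ler_nat.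
move=> S2 T2 E1 E2; apply/eqP; rewrite -(eqr_nat R); apply/eqP.
move: S2 T2 E1 E2; move: {s2 t2}(t%:R : R) (s%:R : R) => {}t {}s S2 T2.
set u := t ^+ 2 + t; set v := s ^+ 2 + s => E1 E2.
have u6 : 6%:R <= u by rewrite /u; nra.
have v6 : 6%:R <= v by rewrite /v; nra.
have : (v - u) * (v ^+ 2 * u ^+ 2 - 3%:R * u * v - u - v) = 0.
  transitivity ((v + 1) ^+ 3 * u ^+ 2 - (u + 1) ^+ 3 * v ^+ 2); first by ring.
  by rewrite E1 E2; ring.
move/eqP; rewrite mulf_eq0 => /orP[|/eqP].
  have -> : v - u = (s - t) * (s + t + 1) by rewrite /u /v; ring.
  by rewrite mulf_eq0 => /orP[] /eqP; lra.
have : 36%:R <= u * v by nra.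
by nra.
Qed.

Lemma prod_lie_inj t s : (2 <= t)%N -> (2 <= s)%N ->
  lie_isomorphic (prod_lie R t) (prod_lie R s) -> t = s.
Proof.
move=> t2 s2 iso; have [t0 s0] := (ltnW t2, ltnW s2).
have [c [M [c0 H]]] := prod_iso_form t0 s0 iso.
have [k []] := form_trace t0 c0 H; rewrite !form_tr2 !form_tr3 => E2 E3.
apply: (form_invariant_inj (k := k) t2 s2); lra.
Qed.
End Invariant.

Theorem mainTheorem2 (R : realType) :
  exists g : nat -> lieAlgebra rat,
    (forall i : nat, lie_dim (g i) = 14%N /\ anosov R (g i)) /\
    (forall i j : nat, i <> j ->
       ~ lie_isomorphic (real_completion R (g i)) (real_completion R (g j))).
Proof.
exists (fun i => quad_lie rat i.+2); split=> [i|i j ij iso].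
  by split; [exact: dim_mat | exact: anosov_quad_lie].
have := lie_isomorphic_trans (lie_isomorphic_trans
  (lie_isomorphic_sym (completion_quad_lie R i.+2)) iso) (completion_quad_lie R j.+2).
by move/(@prod_lie_inj R i.+2 j.+2 isT isT) => [].
Qed.
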